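(* Let $B$ be a set and let $A_b$, for $b\in B$, be a collection of sets indexed by $B$. Then the disjoint union $\coprod_{b\in B}A_b$ is a set.
   Context: The primitive objects are ''collections of elements'' and functions between them; a function $f\colon A\to B$ assigns an element $f[x]\in B$ to each $x\in A$. $\{\text{yes},\text{no}\}$ is a two-element collection, and a binary function is a function with values in it. The primitive hypotheses are: - Two: there is a collection with exactly two elements. - Choice: every surjective function $f\colon A\to B$ of collections of elements has a function $s\colon B\to A$ with $f\circ s=\mathrm{id}_B$. - Infinity: the natural numbers support quantification. - Quantification: if a logical domain supports quantification, so does its powerset. A logical domain is a collection $D$ with a binary pairing $=\colon D\times D\to\{\text{yes},\text{no}\}$ that detects whether elements are the same (''yes'' if they are the same, ''no'' otherwise). Its powerset $\mathsf{P}[D]$ is the collection of all binary functions on $D$. $D$ supports quantification if there is a binary function $\mathsf{P}[D]\to\{\text{yes},\text{no}\}$ that detects the empty (always ''no'') function. A (relaxed) set is a logical domain that supports quantification. The disjoint union $\coprod_{b\in B}A_b$ is the collection of elements of the form $(b,a)$ with $b\in B$ and $a\in A_b$. *)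

(* Defs.v *)
From mathcomp Require Import all_boot.

Set Implicit Arguments.
Unset Strict Implicit.
Unset Printing Implicit Defensive.

(* Collections of elements are types, functions are Rocq functions, and the
   two-element collection {yes, no} is [bool].  An assertion about elements is a
   [Prop], which need not be detected by a binary function: that is the content
   of the notions below, which for this reason are developed without classical
   axioms. *)

(* [e] is an [Equality.axiom]; the latter is [Type]-valued, hence the [<->]. *)
Definition is_logical_domain (D : Type) : Prop :=
  exists e : D -> D -> bool, forall x y : D, e x y = true <-> x = y.

Definition binary_powerset (D : Type) : Type := D -> bool.

Definition is_empty_function (D : Type) (h : binary_powerset D) : Prop :=
  forall x : D, h x = false.

Definition supports_quantification (D : Type) : Prop :=
  exists q : binary_powerset D -> bool,
    forall h : binary_powerset D, q h = true <-> is_empty_function h.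

Definition is_set (D : Type) : Prop :=
  is_logical_domain D /\ supports_quantification D.

Definition surjective (A B : Type) (f : A -> B) : Prop :=
  forall y : B, exists x : A, f x = y.

Definition two_hypothesis : Prop :=
  exists (T : Type) (a b : T), a <> b /\ forall x : T, x = a \/ x = b.

(* [cancel s f] is the pointwise form of [f \o s = id], so that no function
   extensionality is built into the hypothesis. *)
Definition choice_hypothesis : Prop :=
  forall (A B : Type) (f : A -> B),
    surjective f -> exists s : B -> A, cancel s f.

Definition infinity_hypothesis : Prop := supports_quantification nat.

Definition quantification_hypothesis : Prop :=
  forall D : Type, is_logical_domain D ->
    supports_quantification D -> supports_quantification (binary_powerset D).

Definition disjoint_union (B : Type) (A : B -> Type) : Type := {b : B & A b}.

(* Main.v *)
Require Import Defs.
From HB Require Import structures.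
From mathcomp Require Import all_boot.

Set Implicit Arguments.
Unset Strict Implicit.
Unset Printing Implicit Defensive.

(** Both structures on the union are built fibrewise. Pairs agree when their first components agree
    and, after transport to a common fibre, so do the second; a binary function is empty when its
    restriction to every fibre is. Each [A b] merely has some detectors, so [dependent_choice] first
    selects a whole family of them. *)

(* A section of the first projection from [{b & {x : T b | P b x}}] selects a
   witness over [b] only up to the equation provided by [cancel], along which it
   is transported. *)
Lemma dependent_choice (Choice : choice_hypothesis)
    (B : Type) (T : B -> Type) (P : forall b, T b -> Prop) :
  (forall b, exists x, P b x) -> exists f : forall b, T b, forall b, P b (f b).
Proof.
move=> exP; have [|s sK] := Choice {b : B & {x : T b | P b x}} B (@projT1 _ _).
  by move=> b; have [x Px] := exP b; exists (existT _ b (exist _ x Px)).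
pose g b : {x : T b | P b x} :=
  eq_rect _ (fun b => {x : T b | P b x}) (projT2 (s b)) b (sK b).
by exists (fun b => sval (g b)) => b; apply: svalP.
Qed.

Lemma detection_eq_axiom (D : Type) (e : D -> D -> bool) :
  (forall x y, e x y = true <-> x = y) -> Equality.axiom e.
Proof. by move=> eP x y; apply: (iffP idP) => /eP. Qed.

(** Transporting second components is unambiguous because decidable equality on [B] makes proofs of
    [b = b'] unique; the [eqType] structure on dependent pairs relies on this. *)
Lemma disjoint_union_logical_domain (Choice : choice_hypothesis)
    (B : Type) (A : B -> Type) :
  is_logical_domain B -> (forall b, is_logical_domain (A b)) ->
  is_logical_domain (disjoint_union A).
Proof.
move=> [eB eBP] /(dependent_choice Choice)[eA eAP].
pose B' : eqType := HB.pack B (hasDecEq.Build B (detection_eq_axiom eBP)).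
pose A' (b : B') : eqType :=
  HB.pack (A b) (hasDecEq.Build (A b) (detection_eq_axiom (eAP b))).
pose eqAB : rel {b : B' & A' b} := eq_op; exists eqAB => u v.
exact: iff_sym (rwP (@eqP {b : B' & A' b} u v)).
Qed.

Lemma disjoint_union_supports_quantification (Choice : choice_hypothesis)
    (B : Type) (A : B -> Type) :
  supports_quantification B -> (forall b, supports_quantification (A b)) ->
  supports_quantification (disjoint_union A).
Proof.
move=> [qB qBP] /(dependent_choice Choice)[qA qAP].
(* The negation turns the fibre detector into a test for nonemptiness, so [qB] answers yes exactly
   when no fibre is hit. *)
exists (fun h => qB (fun b => ~~ qA b (fun x => h (existT _ b x)))) => h.
split=> [/qBP h0 [b x] | h0].
  by move/negbFE: (h0 b) => /qAP; apply.
by apply/qBP => b; apply/negbF/qAP => x; apply: h0.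
Qed.

Theorem mainTheorem3
    (Two : two_hypothesis)
    (Choice : choice_hypothesis)
    (Infinity : infinity_hypothesis)
    (Quantification : quantification_hypothesis)
    (B : Type) (A : B -> Type) :
  is_set B -> (forall b : B, is_set (A b)) -> is_set (disjoint_union A).
Proof.
move=> [domB quantB] setA; split.
  by apply: disjoint_union_logical_domain => // b; case: (setA b).
by apply: disjoint_union_supports_quantification => // b; case: (setA b).
Qed.
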